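(* Let $D$ be a bounded convex domain in a Banach space $V$, and suppose that $(D,d)$ is a $(1,\kappa)$-quasi-geodesic metric space (for some $\kappa\ge0$), whose topology coincides with the norm topology, satisfying Axiom $1'$ and the condition $$d(sx+(1-s)y,z)\le\max\{d(x,z),d(y,z)\}\quad\text{for all }x,y,z\in D,\ s\in[0,1].$$ If $f:D\to D$ is a compact nonexpansive mapping without bounded orbits, then there exists $\xi\in\partial D$ such that $$\Omega_f\subset\mathrm{ch}(\mathrm{ch}(\xi)).$$
   Context: $\overline{D}$ is the closure of $D$ in the norm topology and $\partial D=\overline{D}\setminus D$. $(D,d)$ is $(1,\kappa)$-quasi-geodesic if every pair of points of $D$ can be connected by a curve $\gamma:[a,b]\to D$ with $|t_1-t_2|-\kappa\le d(\gamma(t_1),\gamma(t_2))\le|t_1-t_2|+\kappa$ for all $t_1,t_2\in[a,b]$. Axiom $1'$ (here with ambient space $(\overline{D},\|\cdot\|)$): the topology of $d$ on $D$ coincides with the norm topology, and for any $w\in D$, if $\{x_n\}\subset D$ converges in norm to a point of $\partial D$, then $d(x_n,w)\to\infty$. $f:D\to D$ is nonexpansive if $d(f(x),f(y))\le d(x,y)$ for all $x,y\in D$; it is compact if the norm closure of $f(D)$ is compact in $\overline{D}$. ''Without bounded orbits'' means that no orbit $\{f^n(y):n\in\mathbb{N}\}$, $y\in D$, is $d$-bounded. Attractor: $\Omega_f=\bigcup_{y\in D}\omega_f(y)$, where $\omega_f(y)$ is the set of $x\in\overline{D}$ for which there is an increasing sequence $\{n_k\}$ with $\lim_{k\to\infty}f^{n_k}(y)=x$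 in norm. For $\xi\in\partial D$ and $F\subset\partial D$: $\mathrm{ch}(\xi)=\{x\in\partial D:[x,\xi]\subset\partial D\}$ and $\mathrm{ch}(F)=\bigcup_{\zeta\in F}\mathrm{ch}(\zeta)$, where $[x,\xi]$ is the closed line segment. *)

(* Defs.v *)
From HB Require Import structures.
From mathcomp Require Import all_boot all_order all_algebra.
From mathcomp Require Import all_classical all_reals all_analysis.

Set Implicit Arguments.
Unset Strict Implicit.
Unset Printing Implicit Defensive.

Import Order.TTheory GRing.Theory Num.Theory.
Import numFieldNormedType.Exports.

Local Open Scope classical_set_scope.
Local Open Scope ring_scope.

(* Metrics on a subset [D] of [V], and self-maps of [D], are represented by
   total functions on [V]; every definition below only uses their values on
   [D]. A Banach space is a [completeNormedModType R] with real scalars [R]; a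
   complex Banach space is covered through its underlying real structure. *)

Definition domain (V : topologicalType) (D : set V) : Prop :=
  [/\ D !=set0, open D & connected D].

(* This is the boundary used for a domain [D]; it is the topological boundary
   only because [D] is open. *)
Definition bdry (V : topologicalType) (D : set V) : set V := closure D `\` D.

Record metric_on (R : realType) (V : Type) (D : set V) (d : V -> V -> R)
    : Prop := MetricOn {
  metric_on_ge0 : forall x y, D x -> D y -> 0 <= d x y ;
  metric_on_eq0 : forall x y, D x -> D y -> (d x y = 0 <-> x = y) ;
  metric_on_sym : forall x y, D x -> D y -> d x y = d y x ;
  metric_on_triangle : forall x y z, D x -> D y -> D z ->
    d x z <= d x y + d y z }.

Definition dopen (R : realType) (V : Type) (D : set V) (d : V -> V -> R)
    (U : set V) : Prop :=
  forall x, U x -> exists2 r : R, 0 < r & [set y | D y /\ d x y < r] `<=` U.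

Definition same_topology (R : realType) (V : topologicalType) (D : set V)
    (d : V -> V -> R) : Prop :=
  forall U, U `<=` D ->
    (dopen D d U <-> exists2 O : set V, open O & U = O `&` D).

Definition axiom1' (R : realType) (V : topologicalType) (D : set V)
    (d : V -> V -> R) : Prop :=
  same_topology D d /\
  forall w, D w -> forall x_ : nat -> V, (forall n, D (x_ n)) ->
    forall x, bdry D x -> x_ @ \oo --> x -> d (x_ n) w @[n --> \oo] --> +oo.

(* "Curve" means continuous map. Continuity is expressed in the topology of [V],
   which agrees with that of [d] on [D] as soon as [same_topology D d] holds. *)
Definition quasi_geodesic1 (R : realType) (V : topologicalType) (D : set V)
    (d : V -> V -> R) (kappa : R) : Prop :=
  forall x y, D x -> D y ->
  exists a b : R, exists gamma : R -> V,
  [/\ a <= b, {within `[a, b], continuous gamma}, set_fun `[a, b] D gamma,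
      gamma a = x /\ gamma b = y &
      forall t1 t2, `[a, b]%classic t1 -> `[a, b]%classic t2 ->
        `|t1 - t2| - kappa <= d (gamma t1) (gamma t2) <= `|t1 - t2| + kappa].

Definition nonexpansive (R : realType) (V : Type) (D : set V)
    (d : V -> V -> R) (f : V -> V) : Prop :=
  forall x y, D x -> D y -> d (f x) (f y) <= d x y.

Definition compact_map (V : topologicalType) (D : set V) (f : V -> V) : Prop :=
  compact (closure (f @` D)).

Definition dbounded (R : realType) (V : Type) (d : V -> V -> R) (A : set V)
    : Prop :=
  exists M : R, forall x y, A x -> A y -> d x y <= M.

Definition orbit_set (V : Type) (f : V -> V) (y : V) : set V :=
  range (fun n => iter n f y).

Definition without_bounded_orbits (R : realType) (V : Type) (D : set V)
    (d : V -> V -> R) (f : V -> V) : Prop :=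
  forall y, D y -> ~ dbounded d (orbit_set f y).

Definition omega_limit (V : topologicalType) (D : set V) (f : V -> V) (y : V)
    : set V :=
  [set x | closure D x /\
    exists2 n_ : nat -> nat, {homo n_ : k l / (k < l)%N} &
      iter (n_ k) f y @[k --> \oo] --> x].

Definition attractor (V : topologicalType) (D : set V) (f : V -> V) : set V :=
  \bigcup_(y in D) omega_limit D f y.

Definition segment (R : realType) (V : lmodType R) (x y : V) : set V :=
  [set s *: x + (1 - s) *: y | s in `[0, 1]].

Definition ch (R : realType) (V : normedModType R) (D : set V) (xi : V)
    : set V :=
  [set x | bdry D x /\ segment x xi `<=` bdry D].

Definition chs (R : realType) (V : normedModType R) (D : set V) (F : set V)
    : set V :=
  \bigcup_(zeta in F) ch D zeta.

(* Main.v *)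
(* Fix [y0] in [D] and let [xi] be a norm limit of [Z = f^n y0] along record
   times [n], at which [d (f^n y0) y0] exceeds all its earlier values.  Then every
   [X = f^k y] with [k <= n] satisfies [d X Z <= d y0 Z + O(1)].  If [X] is close
   to [x] in the attractor, a quasi-geodesic from [X] to [Z] contains a point [w]
   at distance [d X y0 / 2] from [X], so [d w X <= d y0 X - M] and
   [d w Z <= d y0 Z - M] with [M] large.  Because orbits have bounded steps, [f w]
   satisfies the same bounds up to a constant, and the compactness of [f] provides
   a norm limit [z] of the points [f w].  The convexity of the balls of [d] then
   forces [x, z] and [z, xi] into the boundary.  That [x] lies in the boundary at
   all is Calka's theorem: an unbounded orbit has no bounded subsequence. *)

Require Import Defs.
From HB Require Import structures.
From mathcomp Require Import all_boot all_order all_algebra.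
From mathcomp Require Import all_classical all_reals all_analysis.
From mathcomp Require Import lra.

Import Order.TTheory GRing.Theory Num.Theory.
Import numFieldNormedType.Exports.

Set Implicit Arguments.
Unset Strict Implicit.

Local Open Scope classical_set_scope.
Local Open Scope ring_scope.

(** * Metric, norm and boundary preliminaries *)

Lemma metric_on_refl (R : realType) (V : Type) (D : set V) (d : V -> V -> R)
    (d_metric : metric_on D d) (x : V) : D x -> d x x = 0.
Proof. by move=> Dx; apply/(metric_on_eq0 d_metric). Qed.

Lemma compact_seq_cluster (R : realType) (V : normedModType R) (K : set V)
    (u : nat -> V) : compact K -> (forall n, K (u n)) ->
  exists2 z, K z & forall (e : R) N, 0 < e ->
    exists2 n, (N <= n)%N & `|u n - z| < e.
Proof.
move=> Kc Ku.
have [z [Kz clz]] : (K `&` cluster (u @ \oo)) !=set0.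
  by apply: Kc; exists 0%N => // n _; exact: Ku.
exists z => // e N e0.
have [||_ [[n /= Nn <-]]] := clz (u @` [set n | (N <= n)%N]) (ball z e).
- by exists N => // n Nn; exists n.
- exact: nbhsx_ballx.
- by rewrite -ball_normE /= distrC => zn; exists n.
Qed.

Lemma closure_normP (R : realType) (V : normedModType R) (D : set V) (x : V) :
  closure D x <-> forall e : R, 0 < e -> exists2 y, D y & `|y - x| < e.
Proof.
split=> [clx e e0|clx B /nbhs_ballP[e /= e0 xeB]].
  have [y [Dy]] := clx (ball x e) (nbhsx_ballx _ _ e0).
  by rewrite -ball_normE /= distrC; exists y.
have [y Dy yx] := clx _ e0; exists y; split => //; apply: xeB.
by rewrite -ball_normE /= distrC.
Qed.

(** As [D] is open, a [d]-ball is open in [V], hence contains a norm ball about its centre. *)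
Lemma near_interior (R : realType) (V : normedModType R) (D : set V)
    (d : V -> V -> R) (p : V) (e : R) :
  domain D -> metric_on D d -> same_topology D d -> D p -> 0 < e ->
  exists2 r : R, 0 < r & forall u, `|u - p| < r -> D u /\ d u p < e.
Proof.
move=> [_ Dop _] dm dtop Dp e0.
have [||O Oop UO] := (dtop [set u | D u /\ d u p < e] _).1.
- by move=> u [].
- move=> x [Dx xpe]; exists (e - d x p) => [|y [Dy xye]]; first by lra.
  split=> //; have := metric_on_triangle dm Dy Dx Dp.
  by rewrite (metric_on_sym dm Dy Dx); lra.
have Op : O p.
  have : (O `&` D) p by rewrite -UO; split; rewrite // (metric_on_refl dm).
  by case.
have /nbhs_ballP[r /= r0 rO] := open_nbhs_nbhs (conj (openI Oop Dop) (conj Op Dp)).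
exists r => // u ur.
have : (O `&` D) u by apply: rO; rewrite -ball_normE /= distrC.
by rewrite -UO.
Qed.

(** Otherwise, picking [u] within [1/(n+1)] of [xi] for every [n] yields a sequence that contradicts
    Axiom 1'. *)
Lemma boundary_far (R : realType) (V : normedModType R) (D : set V)
    (d : V -> V -> R) (xi w : V) (M : R) :
  axiom1' D d -> bdry D xi -> D w ->
  exists2 r : R, 0 < r & forall u, D u -> `|u - xi| < r -> M < d u w.
Proof.
move=> [_ far] bxi Dw; apply: contrapT => nr.
have {}nr (n : nat) : exists u, [/\ D u, `|u - xi| < n.+1%:R^-1 & d u w <= M].
  apply: contrapT => nu; apply: nr; exists n.+1%:R^-1 => // u Du uxi.
  by rewrite ltNge; apply/negP => uwM; apply: nu; exists u.
have {nr}[u_ uP] := choice nr.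
have ucvg : u_ @ \oo --> xi.
  apply/cvgrPdist_lt => e e0; near=> n.
  have [_ une _] := uP n; rewrite distrC; apply: lt_trans une _.
  by near: n; exact: (near_infty_natSinv_lt (PosNum e0)).
have /cvgryPgt/(_ M) [N _ NP] :=
  far _ Dw u_ (fun n => let: And3 Du _ _ := uP n in Du) _ bxi ucvg.
have [_ _ uM] := uP N.
by have := NP N (leqnn N); rewrite /= ltNge uM.
Unshelve. all: by end_near. Qed.

Lemma segment_sym (R : realType) (V : lmodType R) (x y : V) :
  segment x y `<=` segment y x.
Proof.
move=> _ [s /= s01 <-]; exists (1 - s); last by rewrite subKr addrC.
by move: s01; rewrite /= !in_itv /= => /andP[? ?]; apply/andP; split; lra.
Qed.

(* A point [q] of [u, v] satisfies [d q u <= d v u], whereas [d p u] exceeds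
   [d v u] by an arbitrarily large amount for each fixed [p] in [D]: such [q]
   cannot accumulate inside [D]. *)
Lemma segment_bdry (R : realType) (V : normedModType R) (D : set V)
    (d : V -> V -> R) (y0 x z : V)
    (D_domain : domain D) (D_convex : convex_set D) (d_metric : metric_on D d)
    (d_top : same_topology D d)
    (d_convex : forall x y z : V, D x -> D y -> D z ->
      forall s : R, 0 <= s <= 1 ->
        d (s *: x + (1 - s) *: y) z <= Num.max (d x z) (d y z)) :
  D y0 ->
  (forall e M : R, 0 < e -> exists u v,
    [/\ D u, D v, `|u - x| < e, `|v - z| < e & d v u + M <= d y0 u]) ->
  segment x z `<=` bdry D.
Proof.
move=> Dy0 H _ [s /= s01 <-].
have {s01}/andP[s0 s1] : 0 <= s <= 1 by move: s01; rewrite in_itv.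
have Dseg u v : D u -> D v -> D (s *: u + (1 - s) *: v).
  move=> Du Dv.
  by apply/set_mem; apply: (D_convex u v (Itv01 s0 s1)); exact/mem_set.
have close u v e : 0 < e -> `|u - x| < e -> `|v - z| < e ->
    `|(s *: u + (1 - s) *: v) - (s *: x + (1 - s) *: z)| < e.
  move=> e0 ue ve.
  have -> : (s *: u + (1 - s) *: v) - (s *: x + (1 - s) *: z) =
      s *: (u - x) + (1 - s) *: (v - z).
    by rewrite !scalerBr opprD addrACA.
  apply: le_lt_trans (ler_normD _ _) _; rewrite !normrZ.
  rewrite (ger0_norm s0) ger0_norm ?subr_ge0//.
  by have [->|] := eqVneq s 0; nra.
split.
  apply/closure_normP => e e0; have [u [v [Du Dv ux vz _]]] := H e 0 e0.
  by exists (s *: u + (1 - s) *: v); [exact: Dseg|exact: close].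
set p := _ + _ => Dp.
have [r r0 rP] := near_interior D_domain d_metric d_top Dp ltr01.
(* The margin [d y0 p + 1] clashes with [d y0 u <= d y0 p + d p q + d q u], since [d q p < 1]. *)
have [u [v [Du Dv ux vz uv]]] := H r (d y0 p + 1) r0.
have := rP _ (close _ _ _ r0 ux vz).
set q := _ + _ => -[Dq qp].
have qu : d q u <= d v u.
  have := d_convex u v u Du Dv Du s; rewrite s0 s1 => /(_ isT).
  rewrite (metric_on_refl d_metric)//.
  by rewrite (max_idPr (metric_on_ge0 d_metric Dv Du)).
have := metric_on_triangle d_metric Dy0 Dp Du.
have := metric_on_triangle d_metric Dp Dq Du.
by rewrite (metric_on_sym d_metric Dp Dq); lra.
Qed.

(** * Orbits of nonexpansive maps *)

Section NonexpansiveOrbits.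
Context (R : realType) (V : normedModType R) (D : set V) (d : V -> V -> R)
  (f : V -> V) (D_domain : domain D) (d_metric : metric_on D d)
  (D_axiom1' : axiom1' D d) (f_self : set_fun D D f)
  (f_nonexpansive : nonexpansive D d f).

Let d_top : same_topology D d := D_axiom1'.1.

Lemma iter_self y n : D y -> D (iter n f y).
Proof. by move=> Dy; elim: n => //= n; exact: f_self. Qed.

Lemma iter_nonexpansive x y n : D x -> D y ->
  d (iter n f x) (iter n f y) <= d x y.
Proof.
move=> Dx Dy; elim: n => //= n; apply: le_trans.
by apply: f_nonexpansive; exact: iter_self.
Qed.

Lemma orbit_step y n : D y -> d (f (iter n f y)) (iter n f y) <= d (f y) y.
Proof.
by move=> Dy; rewrite -iterS iterSr; apply: iter_nonexpansive => //; exact: f_self.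
Qed.

Hypothesis f_unbounded : without_bounded_orbits D d f.

Lemma orbit_escapes y M : D y -> exists n, M < d (iter n f y) y.
Proof.
move=> Dy; apply: contrapT => nM; apply: (f_unbounded Dy).
have {}nM n : d (iter n f y) y <= M.
  by rewrite leNgt; apply/negP => ?; apply: nM; exists n.
exists (M + M) => _ _ [m _ <-] [n _ <-].
have [Dm Dn] : D (iter m f y) /\ D (iter n f y) by split; exact: iter_self.
apply: le_trans (metric_on_triangle d_metric Dm Dy Dn) _.
by rewrite (metric_on_sym d_metric Dy Dn) lerD.
Qed.

(** Take the least [n] whose distance exceeds [M] and the first [N] distances: an earlier larger
    value would contradict minimality. *)
Lemma record_time y N M : D y -> exists n,
  [/\ (N <= n)%N, M < d (iter n f y) y &
      forall m, (m <= n)%N -> d (iter m f y) y <= d (iter n f y) y].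
Proof.
move=> Dy; set B := \big[Num.max/M]_(i < N) d (iter i f y) y.
have [|n nB nmin] := @ex_minnP (fun n => B < d (iter n f y) y).
  exact: orbit_escapes.
exists n; split.
- rewrite leqNgt; apply/negP => nN; move: nB; apply/negP; rewrite -leNgt.
  exact: (le_bigmax M (fun i : 'I_N => d (iter i f y) y) (Ordinal nN)).
- exact: le_lt_trans (bigmax_ge_id _ _ _ _) nB.
- move=> m; rewrite leq_eqVlt => /predU1P[->//|mn].
  rewrite leNgt; apply/negP => nm.
  by have := nmin m (lt_trans nB nm); rewrite leqNgt mn.
Qed.

(** * Compactness and limit points of orbits *)

Hypothesis f_compact : compact_map D f.

Lemma image_seq_cluster (u : nat -> V) : (forall n, (f @` D) (u n)) ->
  exists2 z, closure D z & forall (e : R) N, 0 < e ->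
    exists2 n, (N <= n)%N & `|u n - z| < e.
Proof.
move=> uP.
have [n|z zK zP] := compact_seq_cluster (u := u) f_compact.
  exact/subset_closure.
exists z => //; apply: closure_subset zK => _ [x Dx <-]; exact: f_self.
Qed.

Lemma record_cluster y : D y -> exists2 xi, bdry D xi &
  forall (e : R) N, 0 < e -> exists n,
    [/\ (N <= n)%N, `|iter n f y - xi| < e &
      forall m, (m <= n)%N -> d (iter m f y) y <= d (iter n f y) y].
Proof.
move=> Dy.
have [r rP] := choice (fun N => record_time N.+1 N%:R Dy).
have [N|xi clxi xiP] := image_seq_cluster (u := fun N => iter (r N) f y).
  have [+ _ _] := rP N; case: (r N) => // k _.
  by exists (iter k f y) => //; exact: iter_self.
exists xi; last first.
  move=> e N e0; have [k Nk kxi] := xiP e N e0; have [rk _ rec] := rP k.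
  by exists (r k); split=> //; apply: leq_trans Nk (ltnW rk).
(* Were [xi] in [D], orbit points near it would stay within [d xi y + 1] of [y]. *)
split=> // Dxi.
have [e e0 eP] := near_interior D_domain d_metric d_top Dxi ltr01.
have [k Nk kxi] := xiP e (Num.truncn (d xi y + 1)).+1 e0.
have [Dk dk] := eP _ kxi.
have [_ + _] := rP k; apply/negP; rewrite -leNgt.
apply: le_trans (metric_on_triangle d_metric Dk Dxi Dy) _.
have : d xi y + 1 < k%:R.
  by apply: lt_le_trans (truncnS_gt _) _; rewrite ler_nat.
by lra.
Qed.

(* Calka's argument: by recurrence of [x] and compactness, the times at which
   the orbit of [x] visits its unit ball have bounded gaps. *)
Lemma recurrent_bounded x : D x ->
  (forall (e : R) N, 0 < e -> exists2 m, (N < m)%N & d (iter m f x) x < e) ->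
  dbounded d (orbit_set f x).
Proof.
move=> Dx rec.
have [m0 m0_gt0 m0P] := rec 1 0%N ltr01.
have [N NP] : exists N, forall n, d (iter n f x) x < 1 ->
    exists m, [/\ (0 < m)%N, (m <= N)%N & d (iter (m + n) f x) x < 1].
  apply: contrapT => noN.
  (* The extra [m0] rules out [t N = 0], since [x] itself returns at time [m0]; so compactness
     applies to the points [iter (t N) f x]. *)
  have {}noN N : exists n, d (iter n f x) x < 1 /\
      forall m, (0 < m)%N -> (m <= N + m0)%N -> 1 <= d (iter (m + n) f x) x.
    apply: contrapT => nn; apply: noN; exists (N + m0)%N => n nx.
    apply: contrapT => nm; apply: nn; exists n; split=> // m m_gt0 mN.
    by rewrite leNgt; apply/negP => mx; apply: nm; exists m.
  have [t tP] := choice noN.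
  have [N|q clq qP] := image_seq_cluster (u := fun N => iter (t N) f x).
    have [tx tret] := tP N; have [t0|] := posnP (t N).
      by have := tret m0 m0_gt0 (leq_addl _ _); rewrite t0 addn0 leNgt m0P.
    case: (t N) => // k _.
    by exists (iter k f x) => //; exact: iter_self.
  have Dq : D q.
    apply: contrapT => nDq.
    have [r r0 rP] := boundary_far 1 D_axiom1' (conj clq nDq) Dx.
    have [n _ nq] := qP r 0%N r0; have [+ _] := tP n.
    by apply/negP; rewrite -leNgt ltW// rP//; exact: iter_self.
  have [r r0 rP] :=
    near_interior D_domain d_metric d_top Dq (ltac:(lra) : 0 < 4^-1).
  have [n0 _ /rP[Dn0 n0q]] := qP r 0%N r0.
  (* The orbit points at times [t n] and [t n0] are both near [q]. After [m - t n0] more steps the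
     second is near [x], hence so is the first: a return within [n] steps, which is excluded. *)
  have [m m_gt mx] := rec 2^-1 (t n0) (ltac:(lra)).
  have [n mn /rP[Dn nq]] := qP r (m - t n0)%N r0.
  have [_ /(_ (m - t n0)%N)] := tP n.
  rewrite subn_gt0 m_gt => /(_ isT (leq_trans mn (leq_addr _ _))).
  apply/negP; rewrite -ltNge iterD.
  have Dm : D (iter (m - t n0) f (iter (t n) f x)) by do 2! apply: iter_self.
  have Dm0 : D (iter m f x) by exact: iter_self.
  have := metric_on_triangle d_metric Dm Dm0 Dx.
  have := iter_nonexpansive (m - t n0) Dn Dn0.
  rewrite -[iter _ f (iter (t n0) f x)]iterD subnK; last exact: ltnW.
  have := metric_on_triangle d_metric Dn Dq Dn0.
  rewrite (metric_on_sym d_metric Dq Dn0).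
  by lra.
have visit n : exists k, [/\ (k <= n)%N, (n <= k + N)%N & d (iter k f x) x < 1].
  elim: n => [|n [k [kn nk kx]]].
    by exists 0%N; rewrite /= (metric_on_refl d_metric).
  have [kN|kN] := leqP n.+1 (k + N); first by exists k; rewrite ltnW.
  have [m [m_gt0 mN mx]] := NP _ kx.
  exists (m + k)%N; split=> //.
  - by rewrite ltnW// (leq_ltn_trans _ kN)// addnC leq_add2l.
  - have -> : n = (k + N)%N by apply/eqP; rewrite eqn_leq nk -ltnS kN.
    by rewrite -add1n -addnA leq_add2r.
(* From the last visit [k], at most [N] steps lead to time [n], and the orbit stays within 1 of the
   initial stretch bounded by [B]. *)
set B := \big[Num.max/0]_(i < N.+1) d (iter i f x) x.
have bnd n : d (iter n f x) x <= B + 1.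
  have [k [kn nk kx]] := visit n.
  have Dk : D (iter k f x) by exact: iter_self.
  have Dn : D (iter n f x) by exact: iter_self.
  have Dj : D (iter (n - k) f x) by exact: iter_self.
  have jN : (n - k < N.+1)%N by rewrite ltnS leq_subLR.
  have := le_bigmax 0 (fun i : 'I_N.+1 => d (iter i f x) x) (Ordinal jN).
  rewrite -/B /=.
  have := metric_on_triangle d_metric Dn Dj Dx.
  have := iter_nonexpansive (n - k) Dk Dx.
  rewrite -iterD subnK//.
  by lra.
exists ((B + 1) + (B + 1)) => _ _ [m _ <-] [n _ <-].
have [Dm Dn] : D (iter m f x) /\ D (iter n f x) by split; exact: iter_self.
apply: le_trans (metric_on_triangle d_metric Dm Dx Dn) _.
by rewrite (metric_on_sym d_metric Dx Dn) lerD.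
Qed.

(** If [x] were in [D], two visits of the orbit of [y] near [x], [m] steps apart, would put
    [iter m f x] near [x]; so [x] would be recurrent. *)
Lemma omega_limit_bdry y : D y -> omega_limit D f y `<=` bdry D.
Proof.
move=> Dy x [clx [n_ n_incr n_x]]; split=> // Dx.
apply: (f_unbounded Dx); apply: recurrent_bounded => // e N e0.
have [r r0 rP] :=
  near_interior D_domain d_metric d_top Dx (ltac:(lra) : 0 < e / 2).
have /cvgrPdist_lt/(_ _ r0)[k0 _ kP] := n_x.
have n_ge k : (k <= n_ k)%N.
  by elim: k => // k IH; apply: leq_ltn_trans IH (n_incr _ _ (ltnSn k)).
set k1 := (n_ k0 + N + k0).+1.
have k1P : (n_ k0 + N < n_ k1)%N.
  by apply: leq_trans (n_ge _); rewrite ltnS leq_addr.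
exists (n_ k1 - n_ k0)%N; first by rewrite ltn_subRL.
have [D0 x0] : D (iter (n_ k0) f y) /\ d (iter (n_ k0) f y) x < e / 2.
  by apply: rP; rewrite distrC; apply: kP => /=.
have [D1 x1] : D (iter (n_ k1) f y) /\ d (iter (n_ k1) f y) x < e / 2.
  by apply: rP; rewrite distrC; apply: kP => /=; rewrite /k1 leqW// leq_addl.
set m := (_ - _)%N.
have Dm : D (iter m f x) by exact: iter_self.
have := metric_on_triangle d_metric Dm D1 Dx.
have := iter_nonexpansive m Dx D0.
rewrite -iterD subnK; last by rewrite ltnW// (leq_ltn_trans _ k1P)// leq_addr.
by rewrite (metric_on_sym d_metric Dx D0); lra.
Qed.

End NonexpansiveOrbits.

(** * Quasi-geodesics and the limit argument *)

(** Take parameter [a + t]: [t + kappa <= d x z] keeps it in [[a, b]], and [b - a <= d x z + kappa]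
    costs the second [kappa]. *)
Lemma quasi_geodesic_point (R : realType) (V : topologicalType) (D : set V)
    (d : V -> V -> R) (kappa : R) (x z : V) (t : R) :
  quasi_geodesic1 D d kappa -> D x -> D z ->
  0 <= t -> t + kappa <= d x z ->
  exists w, [/\ D w, d w x <= t + kappa & d w z <= d x z - t + 2 * kappa].
Proof.
move=> qg Dx Dz t0 td.
have [a [b [g [ab _ gD [ga gb] gP]]]] := qg x z Dx Dz.
have ia : `[a, b]%classic a by rewrite /= in_itv /= lexx.
have ib : `[a, b]%classic b by rewrite /= in_itv /= lexx ab.
have /andP[_] := gP _ _ ia ib.
have /andP[+ _] := gP _ _ ia ib.
rewrite ga gb distrC (ger0_norm (_ : 0 <= b - a)) ?subr_ge0// => ba1 ba2.
have it : `[a, b]%classic (a + t) by rewrite /= in_itv /=; apply/andP; split; lra.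
exists (g (a + t)); split; first exact: gD.
  by have /andP[_] := gP _ _ it ia; rewrite ga addrAC subrr add0r ger0_norm.
have /andP[_] := gP _ _ it ib; rewrite gb distrC ger0_norm; lra.
Qed.

Unset Implicit Arguments.

Theorem theorem4p4 (R : realType) (V : completeNormedModType R)
    (D : set V) (d : V -> V -> R) (kappa : R) (f : V -> V)
    (D_domain : domain D) (D_bounded : bounded_set D) (D_convex : convex_set D)
    (d_metric : metric_on D d)
    (kappa_ge0 : 0 <= kappa) (D_quasi_geodesic : quasi_geodesic1 D d kappa)
    (D_axiom1' : axiom1' D d)
    (d_convex : forall x y z : V, D x -> D y -> D z ->
      forall s : R, 0 <= s <= 1 ->
        d (s *: x + (1 - s) *: y) z <= Num.max (d x z) (d y z))
    (f_self : set_fun D D f) (f_nonexpansive : nonexpansive D d f)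
    (f_compact : compact_map D f)
    (f_unbounded : without_bounded_orbits D d f) :
  exists2 xi : V, bdry D xi & attractor D f `<=` chs D (ch D xi).
Proof.
have [[y0 Dy0] _ _] := D_domain.
have itD := iter_self f_self.
have sym := metric_on_sym d_metric.
have tri := metric_on_triangle d_metric.
have [xi bxi xiP] := record_cluster D_domain d_metric D_axiom1' f_self
  f_unbounded f_compact Dy0.
exists xi => // x [y Dy x_omega].
have bx : bdry D x := omega_limit_bdry D_domain d_metric D_axiom1' f_self
  f_nonexpansive f_unbounded f_compact Dy x_omega.
have [_ [n_ _ /cvgrPdist_lt n_x]] := x_omega.
(* The losses: passing from [y] to [y0], one step of each orbit, and the quasi-geodesic error. *)
set c := d y y0 + d (f y) y + d (f y0) y0 + 2 * kappa.
have approx (j : nat) : exists u : V * V * V, let: (X, W, Z) := u in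
    [/\ [/\ D X, (f @` D) W & D Z], `|X - x| < j.+1%:R^-1,
      `|Z - xi| < j.+1%:R^-1, d W X + j%:R <= d y0 X & d W Z + j%:R <= d y0 Z].
  have j0 : 0 < j.+1%:R^-1 :> R by rewrite invr_gt0.
  (* Half of [d X y0] must absorb [j + c]. *)
  have [r r0 rP] := boundary_far (2 * (j%:R + c)) D_axiom1' bx Dy0.
  have [k _ /(_ k (leqnn k)) /=] :
      \forall k \near \oo, `|x - iter (n_ k) f y| < Num.min r j.+1%:R^-1.
    by apply: n_x; rewrite lt_min r0.
  rewrite lt_min distrC => /andP[Xr Xj].
  move: (n_ k) Xr Xj => {}k Xr Xj.
  set X := iter k f y in Xr Xj *.
  have DX : D X by exact: itD.
  have aP := rP _ DX Xr; set a := d X y0 in aP.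
  (* This gives [d X Z >= b - a > a + kappa], so the parameter [a / 2] is admissible. *)
  have [r' r'0 r'P] := boundary_far (2 * a + kappa) D_axiom1' bxi Dy0.
  have [|n [kn + rec]] := xiP (Num.min r' j.+1%:R^-1) k.
    by rewrite lt_min r'0.
  rewrite lt_min => /andP[Zr Zj].
  set Z := iter n f y0 in Zr Zj rec *.
  have DZ : D Z by exact: itD.
  have bP := r'P _ DZ Zr; set b := d Z y0 in bP rec.
  have [c1 c2 c3] : [/\ 0 <= d y y0, 0 <= d (f y) y & 0 <= d (f y0) y0].
    by split; apply: (metric_on_ge0 d_metric) => //; exact: f_self.
  have a0 : 0 <= a by exact: (metric_on_ge0 d_metric).
  have tXZ := tri _ _ _ DZ DX Dy0.
  rewrite (sym Z X)// -/a -/b in tXZ.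
  have [||w [Dw wX wZ]] :=
    quasi_geodesic_point (t := a / 2) D_quasi_geodesic DX DZ.
  - by lra.
  - by lra.
  have DfX : D (f X) by exact: f_self.
  have DfZ : D (f Z) by exact: f_self.
  have Dfw : D (f w) by exact: f_self.
  have DX0 : D (iter k f y0) by exact: itD.
  exists (X, f w, Z); split=> //; first by split=> //; exists w.
  - have := tri _ _ _ Dfw DfX DX.
    have := f_nonexpansive _ _ Dw DX.
    have := orbit_step f_self f_nonexpansive k Dy.
    rewrite (sym y0 X)// -/X -/a.
    by rewrite /c in aP; lra.
  - have := tri _ _ _ Dfw DfZ DZ.
    have := f_nonexpansive _ _ Dw DZ.
    have := orbit_step f_self f_nonexpansive n Dy0.
    have := tri _ _ _ DX DX0 DZ.
    have := iter_nonexpansive f_self f_nonexpansive k Dy Dy0.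
    (* The record at [n] bounds [d (iter (n - k) f y0) y0] by [b]; applying [f] [k] times gives
       [d (iter k f y0) Z <= b], whence [d X Z <= b + d y y0]. *)
    have := rec _ (leq_subr k n).
    have := iter_nonexpansive f_self f_nonexpansive k Dy0 (itD _ (n - k)%N Dy0).
    rewrite -iterD subnKC// -/X -/Z (sym y0 Z)// -/b.
    rewrite (sym (iter k f y0) Z)//.
    have := sym y0 (iter (n - k) f y0) Dy0 (itD _ _ Dy0).
    by rewrite /c in aP; lra.
have [u uP] := choice approx.
have [j|z clz zP] := image_seq_cluster f_self f_compact (u := fun j => (u j).1.2).
  by have := uP j; case: (u j) => -[X W] Z [[]].
have close (e M : R) : 0 < e -> exists X W Z : V,
    [/\ [/\ D X, D W & D Z], [/\ `|X - x| < e, `|W - z| < e & `|Z - xi| < e],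
      d W X + M <= d y0 X & d W Z + M <= d y0 Z].
  move=> e0.
  (* One index [j] serves both purposes: [1/(j+1) < e] and [M < j]. *)
  have [N _ NP] := near_infty_natSinv_lt (PosNum e0).
  have [j] := zP e (maxn N (Num.truncn M).+1) e0.
  rewrite geq_max => /andP[Nj Mj].
  have ej : j.+1%:R^-1 < e := NP j Nj.
  have {Mj}Mj : M < j%:R.
    by apply: lt_le_trans (truncnS_gt _) _; rewrite ler_nat.
  have := uP j; case: (u j) => -[X W] Z /= [[DX [w Dw <-] DZ] Xx Zxi wX wZ] Wz.
  exists X, (f w), Z; split.
  - by split=> //; exact: f_self.
  - by split=> //; exact: lt_trans ej.
  - by lra.
  - by lra.
have x_z : segment x z `<=` bdry D.
  apply: (segment_bdry D_domain D_convex d_metric D_axiom1'.1 d_convex Dy0).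
  move=> e M e0; have [X [W [Z [[? ? ?] [? ? ?] ? ?]]]] := close e M e0.
  by exists X, W.
have xi_z : segment xi z `<=` bdry D.
  apply: (segment_bdry D_domain D_convex d_metric D_axiom1'.1 d_convex Dy0).
  move=> e M e0; have [X [W [Z [[? ? ?] [? ? ?] ? ?]]]] := close e M e0.
  by exists Z, W.
exists z; last by [].
split; last exact: subset_trans (@segment_sym _ _ _ _) xi_z.
(* [z] is the endpoint of [segment x z] at parameter 0, hence a boundary point. *)
by apply: x_z; exists 0; rewrite /= ?in_itv /= ?lexx ?ler01// scale0r subr0 scale1r add0r.
Qed.
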